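(* Let $E$ and $F$ be infinite-dimensional Banach spaces, $1\le p<q<\infty$ and $1\le s\le\infty$. Suppose that $\mathcal K_q(\ell_1,\overline{\ell}_s)\setminus\mathcal K_p(\ell_1,\overline{\ell}_s)$ is non-empty and that $\ell_s^n$ embed uniformly in $F$. Then $\mathrm{Lip}_{0,\mathcal K_q}(E,F)\setminus\mathrm{Lip}_{0,\mathcal K_p}(E,F)$ is empty or spaceable (as a subset of the Banach space $(\mathrm{Lip}_{0,\mathcal K_q}(E,F),\|\cdot\|_{\mathrm{Lip}_{0,\mathcal K_q}})$).
   Context: Banach spaces are over $\mathbb K=\mathbb R$ or $\mathbb C$; $B_E$ is the open unit ball of $E$; $\overline{\ell}_s=\ell_s$ if $s<\infty$ and $\overline{\ell}_\infty=c_0$; $\ell_s^n$ is $\mathbb K^n$ with the $\ell_s$-norm. For $1\le p<\infty$ with conjugate index $p'$, a set $K\subset F$ is (relatively) $p$-compact if there is a sequence $(x_n)_n$ in $F$ with $\sum_n\|x_n\|^p<\infty$ and $K\subset\{\sum_n\alpha_nx_n:(\alpha_n)_n\in B_{\ell_{p'}}\}$; $m_p(K;F)$ is the infimum of $(\sum_n\|x_n\|^p)^{1/p}$ over all such sequences. $\mathcal K_p(E,F)$ is the space of bounded linear $T:E\to F$ with $T(B_E)$ $p$-compact. $\mathrm{Lip}_0(E,F)$ is the space of Lipschitz maps $f:E\to F$ with $f(0)=0$. Such an $f$ is $p$-compact if the set $\{\frac{f(x)-f(y)}{\|x-y\|}:x\ne y\}\subset F$ is $p$-compact; $\mathrm{Lip}_{0,\mathcal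 K_p}(E,F)$ is the Banach space of these with norm $\|f\|_{\mathrm{Lip}_{0,\mathcal K_p}}=m_p(\{\frac{f(x)-f(y)}{\|x-y\|}:x\ne y\};F)$. $\ell_s^n$ embed uniformly in $F$ if there are subspaces $F_n\subset F$ ($n\in\mathbb N$) with $\sup_nd(F_n,\ell_s^n)<\infty$, $d$ being the Banach–Mazur distance. A subset $A$ of a topological vector space $X$ is spaceable if $A\cup\{0\}$ contains a closed infinite-dimensional linear subspace of $X$. *)

(* Defs.v *)
From HB Require Import structures.
From mathcomp Require Import all_boot all_order all_algebra.
From mathcomp Require Import complex.
From mathcomp Require Import all_classical all_reals all_analysis.

Set Implicit Arguments.
Unset Strict Implicit.
Unset Printing Implicit Defensive.
Import Order.TTheory GRing.Theory Num.Theory.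
Import numFieldNormedType.Exports.

Local Open Scope classical_set_scope.
Local Open Scope ring_scope.

Variant scalar_kind := RealScalars | ComplexScalars.

Definition scalars (R : realType) (k : scalar_kind) : numFieldType :=
  match k with
  | RealScalars => R
  | ComplexScalars => R[i]
  end.

Definition scalar_re (R : realType) (k : scalar_kind) : scalars R k -> R :=
  match k with
  | RealScalars => fun x => x
  | ComplexScalars => fun x => complex.Re x
  end.

(* In the library the norm of a normed module over K takes its values in K;
   [rnorm] is the same norm as an element of R. *)
Definition rnorm (R : realType) (k : scalar_kind)
    (V : normedZmodType (scalars R k)) (x : V) : R :=
  scalar_re `|x|.

(* A normed space carried by a linear subspace of an ambient vector space.
   Functions on, and the norm of, the ambient space only matter on the carrier.
   This covers Banach spaces, their subspaces, sequence spaces and spaces of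
   Lipschitz maps alike. *)
Record normed_space (R : realType) (k : scalar_kind) := NormedSpace {
  ambient : lmodType (scalars R k);
  carrier : set ambient;
  nrm : ambient -> \bar R }.

Arguments ambient {R k} X : rename.
Arguments carrier {R k} X _ : rename.
Arguments nrm {R k} X _ : rename.

Section NormedSpaces.
Context {R : realType} {k : scalar_kind}.
Local Unset Implicit Arguments.
Local Notation K := (scalars R k).
Local Notation nspace := (normed_space R k).
Local Open Scope ereal_scope.

Definition subspace_of {F : normedModType K} (W : set F) : nspace :=
  @NormedSpace R k F W (fun x => (rnorm x)%:E).

Definition whole (F : normedModType K) : nspace := subspace_of [set: F].

Definition finite_dim {V : lmodType K} (W : set V) : Prop :=
  exists (n : nat) (v : 'I_n -> V), (forall i, W (v i)) /\
    forall x, W x -> exists c : 'I_n -> K, x = (\sum_i c i *: v i)%R.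

(* Closedness is in the metric of the norm of X, relative to the carrier. *)
Definition closed_in (X : nspace) (W : set (ambient X)) : Prop :=
  forall x, carrier X x ->
    (forall e : R, (0 < e)%R -> exists2 y, W y & nrm X (x - y)%R < e%:E) -> W x.

Definition spaceable (X : nspace) (A : set (ambient X)) : Prop :=
  exists W : set (ambient X),
    [/\ W `<=` carrier X, GRing.submod_closed [in W], ~ finite_dim W,
        closed_in X W & W `<=` A `|` [set 0%R]].

Definition ell_norm (s : \bar R) (a : nat -> K) : \bar R :=
  Lnorm counting s (fun n => (rnorm (a n))%:E).

(* l_s for s < oo, and c_0 for s = oo *)
Definition ell_bar (s : \bar R) : nspace :=
  @NormedSpace R k (nat -> K^o)
    [set a | ell_norm s a < +oo /\
             (s = +oo -> (fun n => rnorm (a n)) @ \oo --> (0%R : R))]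
    (ell_norm s).

(* l_s^n; the norm is computed on the extension of the vector by zero. *)
Definition ell_fin (s : \bar R) (n : nat) : nspace :=
  @NormedSpace R k 'rV[K]_n setT
    (fun x => ell_norm s
       (fun j => if insub j is Some i then x ord0 i else 0%R)).

Definition bounded_linear (X Y : nspace) (T : ambient X -> ambient Y) : Prop :=
  [/\ forall x, carrier X x -> carrier Y (T x),
      forall (a : K) x y, carrier X x -> carrier X y ->
        T (a *: x + y)%R = (a *: T x + T y)%R
    & exists C : R, forall x, carrier X x -> nrm Y (T x) <= C%:E * nrm X x].

Definition op_norm (X Y : nspace) (T : ambient X -> ambient Y) : \bar R :=
  ereal_sup [set nrm Y (T x) | x in [set x | carrier X x /\ nrm X x <= 1]].

(* The value is +oo when X and Y are not isomorphic. *)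
Definition banach_mazur (X Y : nspace) : \bar R :=
  ereal_inf [set d | exists (T : ambient X -> ambient Y)
                            (S : ambient Y -> ambient X),
    [/\ bounded_linear X Y T, bounded_linear Y X S,
        forall x, carrier X x -> S (T x) = x,
        forall y, carrier Y y -> T (S y) = y
      & d = op_norm X Y T * op_norm Y X S]].

Definition embed_uniformly (s : \bar R) (F : normedModType K) : Prop :=
  exists Fn : nat -> set F,
    (forall n, GRing.submod_closed [in Fn n]) /\
    ereal_sup (range (fun n => banach_mazur (subspace_of (Fn n)) (ell_fin s n)))
      < +oo.

Definition converges_in (X : nspace) (u : nat -> ambient X) (y : ambient X) :=
  carrier X y /\ (fun n => nrm X (y - u n)%R) @ \oo --> 0.

(* The set of all sums of a_n x_n with a in the open unit ball of l_p', where
   p' = oo when p = 1 *)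
Definition p_hull (X : nspace) (p : R) (x : nat -> ambient X) :
    set (ambient X) :=
  [set y | exists2 a : nat -> K, ell_norm (hoelder_conjugate p%:E) a < 1 &
     converges_in X (fun n => (\sum_(0 <= j < n) a j *: x j)%R) y].

Definition p_norm (X : nspace) (p : R) (x : nat -> ambient X) : \bar R :=
  Lnorm counting p%:E (fun n => nrm X (x n)).

Definition p_generates (X : nspace) (p : R) (x : nat -> ambient X)
    (A : set (ambient X)) : Prop :=
  [/\ forall n, carrier X (x n), p_norm X p x < +oo & A `<=` p_hull X p x].

Definition p_compact (X : nspace) (p : R) (A : set (ambient X)) : Prop :=
  exists x, p_generates X p x A.

Definition m_p (X : nspace) (p : R) (A : set (ambient X)) : \bar R :=
  ereal_inf [set p_norm X p x | x in [set x | p_generates X p x A]].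

Definition p_compact_op (p : R) (X Y : nspace) :
    set (ambient X -> ambient Y) :=
  [set T | bounded_linear X Y T /\
     p_compact Y p [set T x | x in [set x | carrier X x /\ nrm X x < 1]]].

Definition Lip0 (E F : normedModType K) : set (E -> F) :=
  [set f | f 0%R = 0%R /\ exists L : K, L.-lipschitz f].

Definition slopes {E F : normedModType K} (f : E -> F) : set F :=
  [set z | exists x y : E, x <> y /\ z = (`|x - y|^-1 *: (f x - f y))%R].

Definition Lip0_p_compact (p : R) (E F : normedModType K) : set (E -> F) :=
  [set f | Lip0 E F f /\ p_compact (whole F) p (slopes f)].

Definition Lip0_p_compact_norm (p : R) (E F : normedModType K) (f : E -> F) :
    \bar R :=
  m_p (whole F) p (slopes f).

Definition Lip0_p_compact_space (p : R) (E F : normedModType K) : nspace :=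
  @NormedSpace R k (E -> F) (Lip0_p_compact p E F)
    (Lip0_p_compact_norm p E F).

End NormedSpaces.

(* Main.v *)
(* If f is q-compact but not p-compact, one element f already produces the whole
   subspace. Cut f off at radius n and place translates of these truncations on
   pairwise disjoint balls, each truncation being repeated in infinitely many
   families indexed by j; let B(a) be the sum in which the pieces of the j-th
   family are multiplied by a_j. A cutoff with slope 1/n costs only a constant
   factor, so the slopes of B(a) lie in a fixed multiple of sup|a| times the
   absolutely convex hull containing the slopes of f: B(a) is q-compact. As the
   j-th family contains arbitrarily large parts of f, the slopes of B(a) contain
   a_j times those of f, so B(a) is not p-compact unless a = 0. The space of all
   B(a) is closed since the norm dominates pointwise convergence. *)
Require Import Defs.
From HB Require Import structures.
From mathcomp Require Import all_boot all_order all_algebra.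
From mathcomp Require Import lra complex.
From mathcomp Require Import all_classical all_reals all_analysis ess_sup_inf.

Import Order.TTheory GRing.Theory Num.Theory.
Import numFieldNormedType.Exports.
Local Open Scope classical_set_scope.
Local Open Scope ring_scope.

(** * Real numbers inside the scalar field, and the real-valued norm *)

Section ScalarEmbedding.
Context {R : realType} {k : scalar_kind}.
Local Notation K := (scalars R k).

Definition of_real (r : R) : K :=
  match k return scalars R k with
  | RealScalars => r
  | ComplexScalars => real_complex R r
  end.

Lemma of_realK r : scalar_re (of_real r) = r.
Proof. by rewrite /of_real; case: k. Qed.

Lemma of_realD r s : of_real (r + s) = of_real r + of_real s.
Proof. by rewrite /of_real; case: k => //; rewrite rmorphD. Qed.

Lemma of_realB r s : of_real (r - s) = of_real r - of_real s.
Proof. by rewrite /of_real; case: k => //; rewrite rmorphB. Qed.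

Lemma of_realM r s : of_real (r * s) = of_real r * of_real s.
Proof. by rewrite /of_real; case: k => //; rewrite rmorphM. Qed.

Lemma of_real0 : of_real 0 = 0.
Proof. by rewrite /of_real; case: k => //; rewrite rmorph0. Qed.

Lemma of_real1 : of_real 1 = 1.
Proof. by rewrite /of_real; case: k => //; rewrite rmorph1. Qed.

Lemma of_realV r : of_real r^-1 = (of_real r)^-1.
Proof. by rewrite /of_real; case: k => //; rewrite fmorphV. Qed.

Lemma ler_of_real r s : (of_real r <= of_real s) = (r <= s).
Proof. by rewrite /of_real; case: k => //; rewrite lecR. Qed.

Lemma of_real_eq0 r : (of_real r == 0) = (r == 0).
Proof. by rewrite /of_real; case: k => //; rewrite fmorph_eq0. Qed.

Lemma ger0_of_real (x : K) : 0 <= x -> of_real (scalar_re x) = x.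
Proof.
by move: x; rewrite /of_real; case: k => //= x x0; rewrite RRe_real ?ger0_real.
Qed.

Lemma norm_of_real r : `|of_real r| = of_real `|r|.
Proof.
by rewrite /of_real; case: k => //; rewrite normc_def/= expr0n addr0 sqrtr_sqr.
Qed.

Section Norm.
Context {V : normedZmodType K}.
Implicit Types x y : V.

(** A norm is a nonnegative element of [K], hence real, so [rnorm] loses nothing. The norm axioms
    for [rnorm] are pulled back through this identity. *)
Lemma rnormE x : `|x| = of_real (rnorm x).
Proof. by rewrite ger0_of_real. Qed.

Lemma rnorm_ge0 x : 0 <= rnorm x.
Proof. by rewrite -ler_of_real -rnormE of_real0. Qed.

Lemma rnorm0 : rnorm (0 : V) = 0.
Proof. by rewrite /rnorm normr0 -of_real0 of_realK. Qed.

Lemma rnorm_eq0 x : (rnorm x == 0) = (x == 0).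
Proof. by rewrite -[in RHS]normr_eq0 rnormE of_real_eq0. Qed.

Lemma rnorm_gt0 x : (0 < rnorm x) = (x != 0).
Proof. by rewrite lt_def rnorm_ge0 andbT rnorm_eq0. Qed.

Lemma rnormN x : rnorm (- x) = rnorm x.
Proof. by rewrite /rnorm normrN. Qed.

Lemma rnormB x y : rnorm (x - y) = rnorm (y - x).
Proof. by rewrite -rnormN opprB. Qed.

Lemma ler_rnormD x y : rnorm (x + y) <= rnorm x + rnorm y.
Proof. by rewrite -ler_of_real of_realD -!rnormE ler_normD. Qed.

Lemma ler_rnorm_sum (I : Type) (r : seq I) (P : pred I) (F : I -> V) :
  rnorm (\sum_(i <- r | P i) F i) <= \sum_(i <- r | P i) rnorm (F i).
Proof.
elim/big_ind2: _ => //; first by rewrite rnorm0.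
by move=> a x b y ax yb; rewrite (le_trans (ler_rnormD _ _))// lerD.
Qed.

Lemma ler_rnormB x y : rnorm x - rnorm y <= rnorm (x - y).
Proof. by rewrite lerBlDr (le_trans _ (ler_rnormD _ _))// subrK. Qed.

End Norm.

Lemma rnorm_of_real r : rnorm (of_real r : K) = `|r|.
Proof. by rewrite /rnorm norm_of_real of_realK. Qed.

Lemma rnormZ {V : normedModType K} (a : K) (v : V) :
  rnorm (a *: v) = rnorm a * rnorm v.
Proof. by rewrite -[RHS]of_realK of_realM -!rnormE -normrZ. Qed.

Lemma rnormM (a b : K) : rnorm (a * b) = rnorm a * rnorm b.
Proof. by rewrite -[RHS]of_realK of_realM -!rnormE -normrM. Qed.

Lemma rnorm1 : rnorm (1 : K) = 1.
Proof. by rewrite -of_real1 rnorm_of_real normr1. Qed.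

End ScalarEmbedding.

Arguments of_real {R} k r.

(** * Completeness of the scalars and closedness of lines *)

(** The hypothesis bounds every left endpoint [b m - e m] by every right endpoint [b n + e n], so
    the supremum of the left endpoints lies in all the intervals. *)
Lemma sup_nested_intervals {R : realType} (b e : nat -> R) :
  (forall m n, `|b m - b n| <= e m + e n) ->
  exists l, forall m, `|l - b m| <= e m.
Proof.
move=> be; pose A := range (fun m => b m - e m).
have A0 : A !=set0 by exists (b 0%N - e 0%N), 0%N.
have ubA n : ubound A (b n + e n).
  move=> _ [m _ <-]; move: (be m n); rewrite ler_norml => /andP[_].
  by lra.
exists (sup A) => m; rewrite ler_norml; apply/andP; split.
  rewrite lerBrDl; apply: ub_le_sup; first by exists (b 0%N + e 0%N).
  by exists m.
by rewrite lerBlDl; apply: ge_sup.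
Qed.

(** Completeness of the scalars with an explicit error. Over the complex numbers the real and
    imaginary parts are treated separately, which costs the factor 2. *)
Lemma scalars_cauchy {R : realType} {k : scalar_kind} (b : nat -> scalars R k)
    (e : nat -> R) :
  (forall m n, rnorm (b m - b n) <= e m + e n) ->
  exists l, forall m, rnorm (l - b m) <= e m *+ 2.
Proof.
case: k b => /= b be.
  have [l lb] := sup_nested_intervals b e be.
  exists l => m; rewrite (le_trans (lb m))// mulr2n lerDl.
  by rewrite (le_trans _ (lb m)).
have Re_le (z : R[i]) : `|complex.Re z| <= complex.Re `|z|.
  by have := normc_ge_Re z; rewrite lecE => /andP[_].
have Im_le (z : R[i]) : `|complex.Im z| <= complex.Re `|z|.
  rewrite normc_def /= -sqrtr_sqr ler_wsqrtr // lerDr sqr_ge0 //.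
have norm_le (z : R[i]) : complex.Re `|z| <= `|complex.Re z| + `|complex.Im z|.
  rewrite normc_def /= -[leRHS]ger0_norm ?addr_ge0// -sqrtr_sqr ler_wsqrtr//.
  rewrite sqrrD !real_normK ?num_real// addrAC lerDl mulrn_wge0//.
have [|x xb] := sup_nested_intervals (fun m => complex.Re (b m)) e.
  by move=> m n; rewrite -raddfB (le_trans (Re_le _))// be.
have [|y yb] := sup_nested_intervals (fun m => complex.Im (b m)) e.
  by move=> m n; rewrite -raddfB (le_trans (Im_le _))// be.
exists (x +i* y)%C => m; rewrite /rnorm /= (le_trans (norm_le _))//.
by rewrite mulr2n; case: (b m) (xb m) (yb m) => u v /= ? ?; rewrite lerD.
Qed.

Lemma line_closed {R : realType} {k : scalar_kind}
    {V : normedModType (scalars R k)} (v w : V) : v != 0 ->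
  (forall e : R, 0 < e -> exists b : scalars R k, rnorm (w - b *: v) < e) ->
  exists b : scalars R k, w = b *: v.
Proof.
rewrite -rnorm_gt0 => v0 wv.
have /choice[b bP] n := wv (n.+1%:R^-1) ltac:(by rewrite invr_gt0 ltr0n).
have dist m n : rnorm (b m - b n) <=
    m.+1%:R^-1 / rnorm v + n.+1%:R^-1 / rnorm v.
  rewrite -mulrDl ler_pdivlMr// -rnormZ scalerBl.
  have -> : b m *: v - b n *: v = (w - b n *: v) - (w - b m *: v).
    by rewrite opprB [RHS]addrC addrA subrK.
  by rewrite (le_trans (ler_rnormD _ _))// rnormN addrC lerD// ltW.
have [l lP] := scalars_cauchy _ _ dist.
exists l; apply/eqP; rewrite -subr_eq0 -rnorm_eq0 eq_le rnorm_ge0 andbT.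
apply/ler_addgt0Pl => e e0; rewrite addr0.
(* One of the three summands pays for the choice of [b n], the other two for the error in
   [scalars_cauchy]. *)
have [n nP] : exists n : nat, n.+1%:R^-1 *+ 3 <= e.
  exists (Num.bound (3 / e)).
  rewrite -[_ *+ 3]mulr_natl ler_pdivrMr ?ltr0n// mulrC -ler_pdivrMr//.
  rewrite (le_trans (ltW (archi_boundP _)))// ?divr_ge0 ?(ltW e0)//.
  by rewrite ler_nat.
apply: le_trans nP.
have -> : w - l *: v = (w - b n *: v) - (l - b n) *: v.
  by rewrite scalerBl opprB addrA subrK.
rewrite (le_trans (ler_rnormD _ _))// mulrS lerD ?(ltW (bP n))//.
by rewrite rnormN rnormZ -ler_pdivlMr// mulrnAl lP.
Qed.

(** * Sequence norms: monotonicity, Minkowski and Hölder inequalities *)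

Section CountingNorm.
Context {R : realType}.
Implicit Types (f g : nat -> R) (s : \bar R).
Local Open Scope ereal_scope.
Local Notation "'N_ s [ f ]" := (Lnorm counting s (EFin \o f)).

Lemma counting_setT_gt0 : 0 < (counting [set: nat] : \bar R).
Proof. by rewrite /counting asboolF//; exact: infinite_nat. Qed.

(** Every point has counting measure 1, so a null set is empty: if it contained [n], the first
    [n.+1] Dirac terms would already sum to at least 1. *)
Lemma ae_countingP (P : set nat) :
  almost_everywhere (@counting nat R) P -> forall n, P n.
Proof.
case=> A [_ + PA] n; apply: contraPP => Pn.
have An : A n by exact: PA.
rewrite counting_dirac => A0.
have dA i : 0 <= \d_i A :> \bar R by [].
have := @nneseries_lim_ge R (fun i => \d_i A) xpredT 0%N n.+1 (fun i _ _ => dA i).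
rewrite A0 big_nat_recr//= [X in _ + X]diracE mem_set// => /(le_trans _).
move=> /(_ 1); rewrite leeDr ?sume_ge0// => /(_ isT).
by rewrite lee_fin ler10.
Qed.

Lemma le_Lnorm_counting f g s : 1 <= s ->
  (forall n, `|f n| <= `|g n|)%R -> 'N_s[f] <= 'N_s[g].
Proof.
case: s => [s s1 fg|_ fg|//]; last first.
  rewrite unlock /= counting_setT_gt0; apply: le_ess_sup; apply: nearW => n.
  by rewrite /= lee_fin.
have s0 : (0 < s)%R by rewrite (lt_le_trans ltr01).
have ge0 h : 0 <= \sum_(k <oo) (`|(EFin \o h) k| `^ s).
  by apply: nneseries_ge0 => n _ _; exact: poweR_ge0.
rewrite !Lnorm_counting//; apply: gt0_ler_poweR; rewrite ?in_itv/= ?ge0 ?leey//.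
  by rewrite invr_ge0 ltW.
apply: lee_nneseries => [n _ _|n _]; rewrite lee_fin ?powR_ge0//.
by rewrite ge0_ler_powR// ?nnegrE// ltW.
Qed.

Lemma Lnorm_countingZ f s (c : R) : 1 <= s -> (0 <= c)%R ->
  'N_s[(fun n => c * f n)%R] = c%:E * 'N_s[f].
Proof.
case: s => [s s1 c0|_ c0|//]; last first.
  rewrite unlock /= counting_setT_gt0 -ess_supZl//; last exact: counting_setT_gt0.
  by congr ess_sup; apply/funext => n /=; rewrite normrM ger0_norm// EFinM.
have s0 : (0 < s)%R by rewrite (lt_le_trans ltr01).
rewrite !Lnorm_counting//.
under eq_eseriesr => n _ do
  rewrite /= normrM ger0_norm// powRM// EFinM.
rewrite nneseriesZl; last by move=> n _; rewrite lee_fin powR_ge0.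
rewrite poweRM ?lee_fin ?powR_ge0//; last first.
  by apply: nneseries_ge0 => n _ _; rewrite lee_fin powR_ge0.
by rewrite poweR_EFin -powRrM divff ?gt_eqF// powRr1.
Qed.

Lemma Lnorm_counting_comb f g h s (c d : R) : 1 <= s ->
  (0 <= c)%R -> (0 <= d)%R ->
  (forall n, `|h n| <= c * `|f n| + d * `|g n|)%R ->
  'N_s[h] <= c%:E * 'N_s[f] + d%:E * 'N_s[g].
Proof.
move=> s1 c0 d0 hfg.
have -> : 'N_s[f] = 'N_s[(fun n => `|f n|)%R].
  by apply/eqP; rewrite eq_le !le_Lnorm_counting//= => n; rewrite normr_id.
have -> : 'N_s[g] = 'N_s[(fun n => `|g n|)%R].
  by apply/eqP; rewrite eq_le !le_Lnorm_counting//= => n; rewrite normr_id.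
rewrite -!Lnorm_countingZ//; apply: le_trans (eminkowski _ _ _ s1) => //.
apply: le_Lnorm_counting => // n /=.
by rewrite (le_trans (hfg n))//= ler_norm.
Qed.

Lemma hoelder_counting f g (p : R) n : (1 <= p)%R ->
  'N_(hoelder_conjugate p%:E)[f] < +oo ->
  (\sum_(0 <= j < n) `|f j| * `|g j|)%:E <=
  'N_(hoelder_conjugate p%:E)[f] * 'N_(p%:E)[g].
Proof.
move=> p1 + ; have p0 : (0 < p)%R by rewrite (lt_le_trans ltr01).
have sumE (h : nat -> R) : (\sum_(0 <= j < n) `|h j|)%:E <= 'N_1[h].
  rewrite Lnorm1 ge0_integral_count//; apply: le_trans (nneseries_lim_ge n _) => //.
  by rewrite sumEFin.
move: p1; rewrite le_eqVlt => /predU1P[<-|p1].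
  rewrite hoelder_conjugate1 => foo.
  (* For p = 1 the conjugate norm is an essential supremum, which bounds every single entry of [f]
     by [ae_countingP]. *)
  have ge0 := Lnorm_ge0 (@counting nat R) +oo (EFin \o f).
  have fN j : `|f j|%:E <= 'N_+oo[f].
    move: j; rewrite unlock /= counting_setT_gt0.
    exact: ae_countingP (ess_sup_ge _ _).
  case E : ('N_+oo[f]) ge0 fN foo => [c| |]// ge0 fN _.
    apply: (@le_trans _ _ (c%:E * (\sum_(0 <= j < n) `|g j|)%:E)).
      rewrite -EFinM lee_fin mulr_sumr; apply: ler_sum => j _.
      by rewrite ler_wpM2r// -lee_fin.
    by apply: lee_wpmul2l => //; exact: sumE.
have p10 : (p - 1 != 0)%R by rewrite subr_eq0 gt_eqF.
have -> : hoelder_conjugate p%:E = (p / (p - 1))%:E.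
  by rewrite /hoelder_conjugate /= gt_eqF ?lte_fin// -EFinB inver (negbTE p10).
move=> _; under eq_bigr do rewrite -normrM.
apply: (le_trans (sumE (f \* g)%R)); apply: hoelder => //.
  by rewrite divr_gt0// subr_gt0.
by rewrite invf_div -[X in (_ + X)%R]mul1r -mulrDl subrK divff// gt_eqF.
Qed.

End CountingNorm.

(** * Absolute convexity and norm bounds of p-hulls *)

Section Hull.
Context {R : realType} {k : scalar_kind}.
Local Notation K := (scalars R k).
Context {F : normedModType K} (p : R).
Hypothesis p_ge1 : 1 <= p.
Local Notation hull := (p_hull (whole F) p).
Implicit Types (x : nat -> F) (z w : F).

Lemma cvg_wholeP (u : nat -> F) z : converges_in (whole F) u z <->
  (fun n => rnorm (z - u n)) @ \oo --> (0 : R).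
Proof.
split=> [[_ uz]|uz].
  have /fine_cvgP[] : (fun n => (rnorm (z - u n))%:E) @ \oo --> 0%:E := uz.
  by [].
by split=> //; apply/fine_cvgP; split=> //; exact: nearW.
Qed.

Lemma p_hull0 x : hull x 0.
Proof.
exists (fun=> 0).
  rewrite /ell_norm; under eq_Lnorm do rewrite rnorm0.
  by rewrite Lnorm0 ?lte01// gt_eqF// (lt_le_trans lte01)// hoelder_conj_ge1.
apply/cvg_wholeP; rewrite (_ : (fun _ => _) = cst 0); first exact: cvg_cst.
by apply/funext => n; rewrite big1 ?subrr ?rnorm0// => j _; rewrite scale0r.
Qed.

(** Combining the two coefficient sequences in the same way represents the new point; the Minkowski
    inequality keeps them in the open unit ball. *)
Lemma p_hull_comb x z w (a b : K) : rnorm a + rnorm b <= 1 ->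
  hull x z -> hull x w -> hull x (a *: z + b *: w).
Proof.
move=> ab [c c1 /cvg_wholeP cz] [d d1 /cvg_wholeP dw].
exists (fun n => a * c n + b * d n); last first.
  apply/cvg_wholeP.
  have lim : (fun n => rnorm a * rnorm (z - \sum_(0 <= j < n) c j *: x j) +
               rnorm b * rnorm (w - \sum_(0 <= j < n) d j *: x j))
      @ \oo --> (0 : R).
    rewrite -[0 : R]addr0 -[X in X + _](mulr0 (rnorm a)).
    rewrite -[X in _ + X](mulr0 (rnorm b)).
    by apply: cvgD; apply: cvgMl_tmp.
  apply: squeeze_cvgr (cvg_cst _) lim; apply: nearW => n.
  rewrite rnorm_ge0 -!rnormZ (le_trans _ (ler_rnormD _ _))//.
  under eq_bigr do rewrite scalerDl -!scalerA.
  by rewrite big_split -!scaler_sumr/= !scalerBr opprD addrACA.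
have q1 : (1 <= hoelder_conjugate p%:E)%E by rewrite hoelder_conj_ge1.
apply: (@le_lt_trans _ _ ((rnorm a)%:E * ell_norm (hoelder_conjugate p%:E) c +
    (rnorm b)%:E * ell_norm (hoelder_conjugate p%:E) d)%E).
  apply: Lnorm_counting_comb; rewrite ?rnorm_ge0// => n.
  by rewrite !ger0_norm ?rnorm_ge0// -!rnormM ler_rnormD.
have ge0 (e : nat -> K) : (0 <= ell_norm (hoelder_conjugate p%:E) e)%E.
  exact: Lnorm_ge0.
case: (ell_norm _ c) (ge0 c) c1 => [r| |]// r0 r1.
case: (ell_norm _ d) (ge0 d) d1 => [t| |]// t0 t1.
rewrite -!EFinM -EFinD !lte_fin !lee_fin in r0 t0 r1 t1 *.
have := rnorm_ge0 a; have := rnorm_ge0 b.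
(* The ball is open, so a strict bound is required: the norm is at most (|a| + |b|) m, hence at most
   m, and m < 1. *)
pose m := Num.max r t; have m1 : m < 1 by rewrite gt_max r1.
have rm : r <= m by rewrite le_max lexx.
have tm : t <= m by rewrite le_max lexx orbT.
by nra.
Qed.

Lemma p_hullZ x z (c : K) : hull x z -> hull (fun n => c *: x n) (c *: z).
Proof.
move=> [a a1 /cvg_wholeP az]; exists a => //; apply/cvg_wholeP.
rewrite -(mulr0 (rnorm c)).
under eq_fun => n.
  under eq_bigr do rewrite scalerA mulrC -scalerA.
  rewrite -scaler_sumr -scalerBr rnormZ; over.
exact: cvgMl_tmp.
Qed.

Lemma p_normZ_lty x (c : K) : (p_norm (whole F) p x < +oo)%E ->
  (p_norm (whole F) p (fun n => (c *: x n : F)) < +oo)%E.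
Proof.
move=> xoo; rewrite [ltLHS](_ : _ = (rnorm c)%:E * p_norm (whole F) p x)%E.
  by rewrite lte_mul_pinfty ?lee_fin ?rnorm_ge0//.
rewrite /p_norm -(Lnorm_countingZ (fun n => rnorm (x n))) ?rnorm_ge0//.
by apply: eq_Lnorm => n; rewrite /= rnormZ.
Qed.

(** Hölder's inequality bounds all partial sums by [e], and the bound passes to the limit. *)
Lemma p_hull_norm x z (e : R) : hull x z -> (p_norm (whole F) p x <= e%:E)%E ->
  rnorm z <= e.
Proof.
move=> [a a1 /cvg_wholeP az] xe.
have part n : rnorm (\sum_(0 <= j < n) a j *: x j) <= e.
  rewrite (le_trans (ler_rnorm_sum _ _ _ _))// -lee_fin.
  have := @hoelder_counting R (fun j => rnorm (a j)) (fun j => rnorm (x j)) p n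
    p_ge1 (lt_trans a1 (ltry _)).
  under eq_bigr do rewrite !ger0_norm ?rnorm_ge0// -rnormZ.
  move=> /le_trans; apply; rewrite -[e%:E]mul1e; apply: lee_pmul.
  - exact: Lnorm_ge0.
  - exact: Lnorm_ge0.
  - exact: ltW.
  - exact: xe.
apply/ler_addgt0Pl => d d0.
have /cvgr_dist_lt/(_ d d0)[n _ /(_ n (leqnn _))] := az.
rewrite sub0r normrN ger0_norm ?rnorm_ge0// => zn.
rewrite -(subrK (\sum_(0 <= j < n) a j *: x j) z).
by rewrite (le_trans (ler_rnormD _ _))// lerD// ltW.
Qed.

End Hull.

(* [N r v] is to be read as "the Minkowski functional of some absolutely convex
   set is at most r at v". *)
Definition gauge {R : realType} {k : scalar_kind}
    {V : normedModType (scalars R k)} (N : R -> V -> Prop) : Prop :=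
  [/\ N 0 0,
      forall r s v w, N r v -> N s w -> N (r + s) (v + w),
      forall r s v, N r v -> r <= s -> N s v
    & forall r (a : scalars R k) v, N r v -> N (rnorm a * r) (a *: v)].

Definition slope_bounded {R : realType} {k : scalar_kind}
    {E F : normedModType (scalars R k)} (N : R -> F -> Prop) (f : E -> F) :=
  forall x y, N (rnorm (x - y)) (f x - f y).

(** * Balls and hulls as gauges; compactness of slopes as a gauge bound *)

Section Gauge.
Context {R : realType} {k : scalar_kind}.
Local Notation K := (scalars R k).
Context {V : normedModType K}.
Implicit Types v w : V.

Lemma ball_gauge (c : R) : 0 <= c -> gauge (fun r v => rnorm v <= c * r).
Proof.
move=> c0; split => [|r s v w vr ws|r s v vr rs|r a v vr].
- by rewrite rnorm0 mulr0.
- by rewrite mulrDr (le_trans (ler_rnormD _ _))// lerD.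
- by rewrite (le_trans vr)// ler_wpM2l.
- by rewrite rnormZ mulrCA ler_wpM2l// rnorm_ge0.
Qed.

Lemma gaugeB {N : R -> V -> Prop} r s v w : gauge N ->
  N r v -> N s w -> N (r + s) (v - w).
Proof.
move=> [_ ND _ NZ] vr ws; apply: ND => //; rewrite -scaleN1r -[s]mul1r.
by rewrite -(rnorm1 (k := k)) -rnormN; exact: NZ.
Qed.

Definition hull_gauge (p : R) (x : nat -> V) (r : R) (v : V) : Prop :=
  0 <= r /\ exists2 z, p_hull (whole V) p x z & v = of_real k r *: z.

(** Each axiom reduces to absolute convexity of the hull; for sums the weights are r/(r+s) and
    s/(r+s). A vanishing denominator is treated apart, the vector then being 0. *)
Lemma hull_gaugeP (p : R) (x : nat -> V) : 1 <= p -> gauge (hull_gauge p x).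
Proof.
move=> p1; have h0 := p_hull0 p p1 x.
have comb := p_hull_comb p p1 x.
split => [|r s v w [r0 [y hy ->]] [s0 [z hz ->]]|r s v [r0 [z hz ->]] rs|
    r a v [r0 [z hz ->]]].
- by split=> //; exists 0 => //; rewrite scaler0.
- split; first exact: addr_ge0.
  have [rs0|rs0] := eqVneq (r + s) 0.
    exists 0; rewrite // scaler0.
    have /eqP := rs0; rewrite paddr_eq0// => /andP[/eqP-> /eqP->].
    by rewrite of_real0 !scale0r addr0.
  exists (of_real k (r / (r + s)) *: y + of_real k (s / (r + s)) *: z).
    apply: comb => //; rewrite !rnorm_of_real !ger0_norm ?divr_ge0 ?addr_ge0//.
    by rewrite -mulrDl divff.
  by rewrite scalerDr !scalerA -!of_realM ![(r + s) * _]mulrC !divfK.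
- split; first exact: le_trans rs.
  have [s0|s0] := eqVneq s 0.
    exists 0; rewrite // scaler0.
    have /eqP -> : r == 0 by rewrite eq_le r0 -s0 rs.
    by rewrite of_real0 scale0r.
  have sp : 0 < s by rewrite lt_def s0 (le_trans r0).
  exists (of_real k (r / s) *: z + 0 *: 0).
    apply: comb => //; rewrite rnorm0 addr0 rnorm_of_real ger0_norm.
      by rewrite ler_pdivrMr// mul1r.
    by rewrite divr_ge0// ltW.
  by rewrite scaler0 addr0 scalerA -of_realM mulrC divfK.
- split; first by rewrite mulr_ge0// rnorm_ge0.
  have [->|a0] := eqVneq a 0.
    by exists 0; rewrite // !scale0r scaler0.
  have na : rnorm a != 0 by rewrite rnorm_eq0.
  exists ((a * of_real k (rnorm a)^-1) *: z + 0 *: 0).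
    apply: comb => //; rewrite rnorm0 addr0 rnormM rnorm_of_real.
    by rewrite ger0_norm ?invr_ge0 ?rnorm_ge0// divff.
  rewrite scaler0 addr0 !scalerA; congr (_ *: _).
  rewrite of_realM of_realV [RHS]mulrACA mulrC -[LHS]mulr1 -mulrA [RHS]mulrC.
  by rewrite -mulrA; congr (_ * _); rewrite mulKf ?mulr1 ?of_real_eq0.
Qed.

Lemma hull_gauge_scale (p : R) (x : nat -> V) (c r : R) v : 0 <= r ->
  hull_gauge p x (c * r) v ->
  hull_gauge p (fun n => of_real k c *: x n) r v.
Proof.
move=> r0 [_ [z hz ->]]; split=> //; exists (of_real k c *: z).
  exact: p_hullZ.
by rewrite scalerA -of_realM mulrC.
Qed.

(** This removes the division from difference quotients: all later estimates concern increments, and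
    coinciding points need no exclusion. *)
Lemma slopes_hullP {E : normedModType K} (p : R) (x : nat -> V) (f : E -> V) :
  1 <= p ->
  slopes f `<=` p_hull (whole V) p x <-> slope_bounded (hull_gauge p x) f.
Proof.
move=> p1; split=> [fx u v|fx _ [u [v [/eqP uv ->]]]].
  have [->|uv] := eqVneq u v.
    by rewrite !subrr rnorm0; have [] := hull_gaugeP p x p1.
  split; first exact: rnorm_ge0.
  exists (`|u - v|^-1 *: (f u - f v)).
    by apply: fx; exists u, v; split=> //; apply/eqP.
  by rewrite -rnormE scalerA divff ?scale1r// normr_eq0 subr_eq0.
have [_ [z hz ->]] := fx u v.
by rewrite -rnormE scalerA mulVf ?scale1r// normr_eq0 subr_eq0.
Qed.

Lemma lipschitzP {E : normedModType K} (f : E -> V) :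
  (exists L : K, L.-lipschitz f) <->
  exists2 c : R, 0 <= c & slope_bounded (fun r v => rnorm v <= c * r) f.
Proof.
split=> [[L fL]|[c c0 fc]]; last first.
  exists (of_real k c) => -[u v] /= _.
  by rewrite !rnormE -of_realM ler_of_real.
exists (rnorm L); first exact: rnorm_ge0.
move=> u v; have /= fuv := fL (u, v) (conj I I).
rewrite -(ler_of_real (k := k)) of_realM -!rnormE (le_trans fuv)//.
(* The product of [L] and the norm of u - v dominates a norm, so it is nonnegative and equals its
   own absolute value; this allows [L] to be replaced by [rnorm L]. *)
by rewrite -[leLHS]ger0_norm ?normrM ?normr_id// (le_trans _ fuv).
Qed.

(** The norm of the space dominates the Lipschitz constant, by [p_hull_norm] applied to each slope.
    Closedness of the constructed subspace rests on this. *)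
Lemma m_p_slopes_lt {E : normedModType K} (p e : R) (f : E -> V) : 1 <= p ->
  (Lip0_p_compact_norm p E V f < e%:E)%E ->
  slope_bounded (fun r v => rnorm v <= e * r) f.
Proof.
move=> p1 /ereal_inf_lt[_ [x [_ _ fx] <-] xe] u v.
have [->|uv] := eqVneq u v; first by rewrite !subrr !rnorm0 mulr0.
have uv0 : 0 < rnorm (u - v) by rewrite rnorm_gt0 subr_eq0.
have /fx/p_hull_norm-/(_ p1 e (ltW xe)) : slopes f (`|u - v|^-1 *: (f u - f v)).
  by exists u, v; split => //; apply/eqP.
rewrite rnormZ rnormE -of_realV rnorm_of_real ger0_norm ?invr_ge0 ?rnorm_ge0//.
by rewrite ler_pdivrMl// mulrC.
Qed.

End Gauge.

(** * A piecewise linear cutoff profile *)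

Definition clamp {R : realType} (t : R) : R := Num.max 0 (Num.min 1 (2 - t)).

Section Clamp.
Context {R : realType}.
Implicit Types s t : R.

Lemma clamp_ge0 t : 0 <= clamp t.
Proof. by rewrite /clamp le_max lexx. Qed.

Lemma clamp_le1 t : clamp t <= 1.
Proof. by rewrite /clamp ge_max ler01 ge_min lexx. Qed.

Lemma clamp1 t : t <= 1 -> clamp t = 1.
Proof.
by move=> t1; rewrite /clamp (min_idPl _) ?(max_idPr _)//; lra.
Qed.

Lemma clamp0 t : 2 <= t -> clamp t = 0.
Proof.
by move=> t2; rewrite /clamp (min_idPr _) ?(max_idPl _)//; lra.
Qed.

Lemma clamp_le t : clamp t <= Num.max 0 (2 - t).
Proof. by rewrite /clamp ge_max !le_max lexx !ge_min lexx !orbT. Qed.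

Lemma clamp_lipschitz s t : `|clamp s - clamp t| <= `|s - t|.
Proof.
wlog st : s t / s <= t => [hw|].
  have [/hw//|/ltW/hw] := leP s t.
  by rewrite distrC [leRHS]distrC.
rewrite [leRHS]distrC (ger0_norm (x := t - s)) ?subr_ge0//.
rewrite ler_norml /clamp.
case: (leP 1 (2 - s)) => s1; case: (leP 1 (2 - t)) => t1;
  rewrite /Num.max; case: ltP => s0; case: ltP => t0; apply/andP; split; lra.
Qed.

End Clamp.

(** * Gluing truncated copies of one map on disjoint balls *)

Section Bubbles.
Context {R : realType} {k : scalar_kind}.
Local Notation K := (scalars R k).
Context {E F : normedModType K} (f : E -> F) (e : E).

Definition truncation (n : nat) (x : E) : F :=
  of_real k (clamp (rnorm x / n.+1%:R)) *: f x.

(** For unit [e], quadratic spacing makes the gaps outgrow the radii 2(n+1): the balls are pairwise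
    disjoint, and none contains the origin. *)
Definition bubble_center (n : nat) : E := of_real k (4 * n.+1%:R ^+ 2) *: e.

(** Outside all balls the default index 0 is harmless, since [truncation 0] vanishes off its own
    ball. *)
Definition bubble_index (x : E) : nat :=
  xget 0%N [set n | rnorm (x - bubble_center n) < 2 * n.+1%:R].

(* [logn 2] takes each value infinitely often, so that for each j the pieces of
   [bubbles (fun i => (i == j)%:R)] contain arbitrarily large parts of [f]. *)
Definition bubbles (a : nat -> K) (x : E) : F :=
  a (logn 2 (bubble_index x)) *:
    truncation (bubble_index x) (x - bubble_center (bubble_index x)).

Lemma truncation_small n x : rnorm x <= n.+1%:R -> truncation n x = f x.
Proof.
move=> xn; rewrite /truncation clamp1 ?of_real1 ?scale1r//.
by rewrite ler_pdivrMr ?mul1r// ltr0n.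
Qed.

Lemma truncation_large n x : 2 * n.+1%:R <= rnorm x -> truncation n x = 0.
Proof.
move=> xn; rewrite /truncation clamp0 ?of_real0 ?scale0r//.
by rewrite ler_pdivlMr// ltr0n.
Qed.

Section SlopeBound.
Context (N : R -> F -> Prop).
Hypotheses (f0 : f 0 = 0) (gaugeN : gauge N) (fN : slope_bounded N f).

Lemma slope_bounded0 x : N (rnorm x) (f x).
Proof. by have := fN x 0; rewrite f0 !subr0. Qed.

(** With cutoff values t at x and s at y, the increment is t(f x - f y) + (t - s) f y. The first
    term contributes 1; the second contributes 2, a cutoff slope 1/(n+1) against a norm of y up to
    2(n+1). *)
Lemma truncation_slope n : slope_bounded (fun r => N (3 * r)) (truncation n).
Proof.
have [N0 ND Nle NZ] := gaugeN.
have n0 : (0 : R) < n.+1%:R by rewrite ltr0n.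
have near x y : rnorm y <= 2 * n.+1%:R ->
    N (3 * rnorm (x - y)) (truncation n x - truncation n y).
  move=> yn; rewrite /truncation.
  set t := clamp (rnorm x / _); set s := clamp (rnorm y / _).
  have -> : of_real k t *: f x - of_real k s *: f y =
      of_real k t *: (f x - f y) + of_real k (t - s) *: f y.
    by rewrite scalerBr of_realB scalerBl addrA subrK.
  have ts : `|t - s| <= rnorm (x - y) / n.+1%:R.
    rewrite (le_trans (clamp_lipschitz _ _))// -mulrBl normrM.
    rewrite [X in _ * X]ger0_norm ?invr_ge0 ?ler_wpM2r ?invr_ge0 ?(ltW n0)//.
    by rewrite ler_norml ler_rnormB andbT lerNl opprB rnormB ler_rnormB.
  apply: Nle (ND _ _ _ _ (NZ _ (of_real k t) _ (fN x y))
                 (NZ _ (of_real k (t - s)) _ (slope_bounded0 y))) _.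
  rewrite !rnorm_of_real (ger0_norm (clamp_ge0 _ : 0 <= t)).
  have t1 : t * rnorm (x - y) <= rnorm (x - y).
    by rewrite ler_piMl ?rnorm_ge0// clamp_le1.
  have : `|t - s| * rnorm y <= rnorm (x - y) / n.+1%:R * (2 * n.+1%:R).
    by apply: ler_pM => //; rewrite rnorm_ge0.
  rewrite mulrCA divfK ?gt_eqF//; lra.
(* One point within radius 2(n+1) suffices, by symmetry; if both lie beyond it, both values
   vanish. *)
move=> x y; have [/near//|yn] := leP (rnorm y) (2 * n.+1%:R).
have [/near-/(_ y)|xn] := leP (rnorm x) (2 * n.+1%:R).
  move=> /(gaugeB _ _ _ _ gaugeN N0); rewrite add0r sub0r opprB.
  by rewrite rnormB.
rewrite !truncation_large ?ltW// subrr.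
by apply: Nle N0 _; rewrite mulr_ge0// rnorm_ge0.
Qed.

(** The truncation decays linearly towards the boundary of its ball: the cutoff is at most 2 -
    |x|/(n+1) while |x| stays below 2(n+1). This controls increments between different balls. *)
Lemma truncation_bound n x :
  N (2 * Num.max 0 (2 * n.+1%:R - rnorm x)) (truncation n x).
Proof.
have [N0 ND Nle NZ] := gaugeN.
have n0 : (0 : R) < n.+1%:R by rewrite ltr0n.
have [xn|xn] := leP (2 * n.+1%:R) (rnorm x).
  by rewrite truncation_large//; apply: Nle N0 _; rewrite mulr_ge0// le_max lexx.
apply: Nle (NZ _ _ _ (slope_bounded0 x)) _.
rewrite rnorm_of_real (ger0_norm (clamp_ge0 _)) (max_idPr _) ?subr_ge0 ?(ltW xn)//.
have := clamp_le (rnorm x / n.+1%:R); rewrite (max_idPr _); last first.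
  by rewrite subr_ge0 ler_pdivrMr// ltW.
move=> c2; have : clamp (rnorm x / n.+1%:R) * rnorm x <=
    (2 - rnorm x / n.+1%:R) * (2 * n.+1%:R).
  by apply: ler_pM; rewrite ?clamp_ge0 ?rnorm_ge0// ltW.
by move=> /le_trans; apply; rewrite mulrCA ler_pM2l// mulrBl divfK ?gt_eqF.
Qed.

End SlopeBound.

Hypothesis (e1 : rnorm e = 1).

(** With u = m+1 < v = n+1, the distance is 4(v-u)(v+u), and v - u is at least 1. *)
Lemma center_dist m n : m != n ->
  2 * m.+1%:R + 2 * n.+1%:R <= rnorm (bubble_center m - bubble_center n).
Proof.
wlog mn : m n / (m < n)%N => [hw|_].
  rewrite neq_ltn => /orP[|] lt; first by rewrite hw// ltn_eqF.
  by rewrite addrC rnormB hw// ltn_eqF.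
rewrite -scalerBl -of_realB rnormZ e1 mulr1 rnorm_of_real distrC.
have : (m.+1%:R + 1 <= n.+1%:R :> R) by rewrite natr1 ler_nat.
have : (0 <= m.+1%:R :> R) by [].
set u := m.+1%:R; set v := n.+1%:R => u0 uv.
by rewrite (le_trans _ (ler_norm _))//; nra.
Qed.

Lemma bubble_indexP n x : rnorm (x - bubble_center n) < 2 * n.+1%:R ->
  bubble_index x = n.
Proof.
move=> xn; rewrite /bubble_index.
case: xgetP => [m _ /= xm|/(_ n)//].
apply/eqP; apply: contraT => /center_dist.
rewrite leNgt => /negP[].
rewrite (_ : _ - _ = (x - bubble_center n) - (x - bubble_center m)); last first.
  by rewrite opprB [RHS]addrC addrA subrK.
by rewrite (le_lt_trans (ler_rnormD _ _))// rnormN addrC ltrD.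
Qed.

Lemma bubbles_translate a n x : rnorm x < 2 * n.+1%:R ->
  bubbles a (x + bubble_center n) = a (logn 2 n) *: truncation n x.
Proof.
by move=> xn; rewrite /bubbles (bubble_indexP n) ?addrK.
Qed.

Lemma bubbles0 a : bubbles a 0 = 0.
Proof.
rewrite /bubbles truncation_large ?scaler0// sub0r rnormN rnormZ e1 mulr1.
set n := bubble_index 0.
have : (1 <= n.+1%:R :> R) by rewrite ler1n.
by rewrite rnorm_of_real; set u := n.+1%:R => u1; rewrite ger0_norm; nra.
Qed.

(** The depths of two points inside their disjoint balls add up to at most their distance: this is
    [center_dist] with the triangle inequality through both centers. A point outside its own ball
    has depth 0 and lies outside the other ball too. *)
Lemma index_dist x y : bubble_index x != bubble_index y ->
  Num.max 0 (2 * (bubble_index x).+1%:R - rnorm (x - bubble_center (bubble_index x))) +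
  Num.max 0 (2 * (bubble_index y).+1%:R - rnorm (y - bubble_center (bubble_index y))) <=
  rnorm (x - y).
Proof.
move: (bubble_indexP ^~ x) (bubble_indexP ^~ y).
move: (bubble_index x) (bubble_index y) => m n mx ny mn.
have xy := rnorm_ge0 (x - y).
have tri (i : nat) (u v : E) :
    rnorm (u - bubble_center i) <= rnorm (u - v) + rnorm (v - bubble_center i).
  by rewrite (le_trans _ (ler_rnormD _ _))// addrA subrK.
have [xm|xm] := leP (2 * m.+1%:R) (rnorm (x - bubble_center m)).
  rewrite (max_idPl _) ?subr_le0// add0r ge_max xy /=.
  have : 2 * n.+1%:R <= rnorm (x - bubble_center n).
    by rewrite leNgt; apply/negP => /mx nm; move: mn; rewrite nm eqxx.
  by have := tri n x y; lra.
have [yn|yn] := leP (2 * n.+1%:R) (rnorm (y - bubble_center n)).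
  rewrite [X in _ + X](max_idPl _) ?subr_le0// addr0 ge_max xy /=.
  have : 2 * m.+1%:R <= rnorm (y - bubble_center m).
    by rewrite leNgt; apply/negP => /ny nm; move: mn; rewrite nm eqxx.
  by have := tri m y x; rewrite (rnormB y x); lra.
rewrite !(max_idPr _) ?subr_ge0 ?(ltW xm) ?(ltW yn)//.
have := center_dist _ _ mn; have := tri n (bubble_center m) x; have := tri n x y.
by rewrite (rnormB (bubble_center m) x); lra.
Qed.

(** With equal indices the factor 3 is that of [truncation_slope]. With different indices,
    [truncation_bound] and [index_dist] even give 2. *)
Lemma bubbles_slope (N : R -> F -> Prop) (a : nat -> K) (M : R) :
  f 0 = 0 -> gauge N -> slope_bounded N f -> (forall j, rnorm (a j) <= M) ->
  slope_bounded (fun r => N (3 * M * r)) (bubbles a).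
Proof.
move=> f0 gN fN aM x y; have [N0 ND Nle NZ] := gN.
have M0 : 0 <= M by apply: le_trans (aM 0%N); exact: rnorm_ge0.
rewrite /bubbles; have [<-|ij] := eqVneq (bubble_index x) (bubble_index y).
  rewrite -scalerBr.
  apply: Nle (NZ _ _ _ (truncation_slope N f0 gN fN _ _ _)) _.
  rewrite opprB addrA subrK -mulrA mulrCA ler_wpM2l//.
  by rewrite ler_wpM2r// rnorm_ge0.
have bound n z := truncation_bound N f0 gN fN n z.
apply: Nle (gaugeB _ _ _ _ gN (NZ _ _ _ (bound _ _)) (NZ _ _ _ (bound _ _))) _.
have := index_dist x y ij.
set u := Num.max 0 _; set v := Num.max 0 _ => uv.
have u0 : 0 <= u by rewrite le_max lexx.
have v0 : 0 <= v by rewrite le_max lexx.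
apply: (@le_trans _ _ (M * (2 * u) + M * (2 * v))).
  by rewrite lerD// ler_wpM2r// mulr_ge0.
have : M * (u + v) <= M * rnorm (x - y) by rewrite ler_wpM2l.
have : 0 <= M * rnorm (x - y) by rewrite mulr_ge0// rnorm_ge0.
by rewrite -!mulrA; lra.
Qed.

End Bubbles.

(** * The subspace of all glued maps with bounded coefficients *)

Lemma logn2_unbounded j m : exists2 n, (m <= n)%N & logn 2 n = j.
Proof.
exists (2 ^ j * (m.*2).+1)%N.
  by rewrite (leq_trans _ (leq_pmull _ _)) ?expn_gt0// -addnn -addnS leq_addr.
rewrite lognM ?expn_gt0// pfactorK// lognE /= dvdn2 /= odd_double.
by rewrite addn0.
Qed.

Lemma le0_small {R : realType} (t C : R) :
  0 <= C -> (forall e, 0 < e -> t <= e * C) -> t <= 0.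
Proof.
move=> C0 tC; apply/ler_addgt0Pl => d d0; rewrite addr0.
have C1 : 0 < C + 1 by rewrite ltr_wpDl.
rewrite (le_trans (tC _ (divr_gt0 d0 C1)))// mulrAC ler_pdivrMr//.
by rewrite ler_wpM2l ?lerDl// ltW.
Qed.

Section BubbleSpace.
Context {R : realType} {k : scalar_kind}.
Local Notation K := (scalars R k).
Context {E F : normedModType K} (f : E -> F) (e x0 : E).
Hypotheses (f0 : f 0 = 0) (e1 : rnorm e = 1) (fx0 : f x0 != 0).
Local Notation B := (bubbles f e).
Implicit Types a b : nat -> K.

Definition bubble_space : set (E -> F) :=
  [set h | exists2 a, (exists M, forall j, rnorm (a j) <= M) & h = B a].

Lemma bubblesP (t : K) a b : B (fun j => t * a j + b j) = t *: B a + B b.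
Proof. by apply/funext => x; rewrite /bubbles scalerDl -scalerA. Qed.

(** In family j there is a ball so large that [u] and [v] fall where the cutoff is 1. The
    translation [z] does not depend on [a], so coefficients of different maps can be compared at one
    point. *)
Lemma bubbles_full j u v : exists z, forall a,
  B a (u + z) = a j *: f u /\ B a (v + z) = a j *: f v.
Proof.
have [n mn nj] := logn2_unbounded j (Num.bound (Num.max (rnorm u) (rnorm v))).
have : Num.max (rnorm u) (rnorm v) <= n.+1%:R.
  rewrite (le_trans (ltW (archi_boundP _))) ?le_max ?rnorm_ge0//.
  by rewrite ler_nat leqW.
rewrite ge_max => /andP[un vn].
have n2 : (n.+1%:R : R) < 2 * n.+1%:R by rewrite ltr_pMl ?ltr0n// ltr1n.
exists (bubble_center e n) => a.
by rewrite !bubbles_translate ?(le_lt_trans _ n2)// nj !truncation_small.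
Qed.

(** [bubbles_slope] is used for two gauges: the ball gauge gives the Lipschitz bound, the hull gauge
    gives q-compactness with the generating sequence scaled by 3M. *)
Lemma bubbles_compact (q : R) a (M : R) : 1 <= q ->
  Lip0_p_compact q E F f -> (forall j, rnorm (a j) <= M) ->
  Lip0_p_compact q E F (B a).
Proof.
move=> q1 [[_ /lipschitzP[c c0 fc]] [x [_ xoo fx]]] aM.
have M0 : 0 <= M by apply: le_trans (aM 0%N); exact: rnorm_ge0.
split.
  split; first exact: bubbles0.
  apply/lipschitzP; exists (c * (3 * M)); first by rewrite !mulr_ge0.
  move=> u v; rewrite -mulrA.
  exact: (bubbles_slope f e e1 _ a M f0 (ball_gauge c c0) fc aM u v).
exists (fun n => of_real k (3 * M) *: x n); split=> //.
  exact: p_normZ_lty.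
move/slopes_hullP : fx => /(_ q1) fx.
apply/slopes_hullP => // u v; apply: hull_gauge_scale; first exact: rnorm_ge0.
exact: (bubbles_slope f e e1 _ a M f0 (hull_gaugeP q x q1) fx aM u v).
Qed.

(** By [bubbles_full], [a j] times any increment of [f] is an increment of [B a] over the same
    distance; dividing a generating sequence for [B a] by [a j] would serve [f]. *)
Lemma bubbles_not_compact (p : R) a j : 1 <= p ->
  ~ p_compact (whole F) p (slopes f) -> a j != 0 ->
  ~ p_compact (whole F) p (slopes (B a)).
Proof.
move=> p1 nf aj [x [_ xoo /(slopes_hullP _ _ _ p1) ax]]; apply: nf.
exists (fun n => (a j)^-1 *: x n); split=> //; first exact: p_normZ_lty.
apply/slopes_hullP => // u v; have [z /(_ a)[uz vz]] := bubbles_full j u v.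
have [d0 [w hw]] := ax (u + z) (v + z).
rewrite uz vz opprD addrACA subrr addr0 -scalerBr => eq.
split; first exact: rnorm_ge0.
exists ((a j)^-1 *: w); first exact: p_hullZ.
by rewrite scalerA mulrC -scalerA -eq scalerA mulVf// scale1r.
Qed.

Lemma bubbles_bounded a (c : R) : 0 <= c ->
  slope_bounded (fun r v => rnorm v <= c * r) (B a) ->
  forall j, rnorm (a j) <= c * rnorm x0 / rnorm (f x0).
Proof.
move=> c0 ac j; have [z /(_ a)[xz oz]] := bubbles_full j x0 0.
rewrite ler_pdivlMr ?rnorm_gt0// -rnormZ.
by have := ac (x0 + z) (0 + z); rewrite xz oz f0 scaler0 subr0 add0r addrK.
Qed.

Lemma bubble_space_submod : GRing.submod_closed [in bubble_space].
Proof.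
split=> [|t g h].
  rewrite in_setE; exists (fun=> 0); first by exists 0 => j; rewrite rnorm0.
  by apply/funext => x; rewrite /bubbles scale0r.
rewrite !in_setE => -[a [M aM] ->] [b [M' bM] ->].
exists (fun j => t * a j + b j); last by rewrite bubblesP.
exists (rnorm t * M + M') => j; rewrite (le_trans (ler_rnormD _ _))//.
by rewrite lerD// rnormM ler_wpM2l ?rnorm_ge0.
Qed.

Lemma bubble_space_infinite : ~ finite_dim bubble_space.
Proof.
move=> [n [v [vB vspan]]].
have /choice[A vA] i : exists a, v i = B a by have [a _ ->] := vB i; exists a.
pose delta (j m : nat) : K := (m == j)%:R.
have dB j : bubble_space (B (delta j)).
  exists (delta j) => //; exists 1 => m; rewrite /delta.
  by case: (m == j); rewrite ?rnorm1 ?rnorm0.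
have /choice[c cP] j := vspan _ (dB j).
pose C : 'M[K]_(n.+1, n) := \matrix_(i, j) c i j.
pose D : 'M[K]_(n, n.+1) := \matrix_(i, j) A i j.
(* Evaluating the expansion of [B (delta i)] at a translate of [x0] in family m extracts the m-th
   coefficient. An identity matrix of size n+1 would then factor through dimension n, contradicting
   the rank bound. *)
have CD : C *m D = 1%:M.
  apply/matrixP => i m; rewrite !mxE.
  have [z zP] := bubbles_full m x0 x0.
  have /(congr1 (fun h => h (x0 + z))) /= := cP i; rewrite fct_sumE (zP _).1.
  have -> : \sum_l (c i l *: v l) (x0 + z) = (\sum_l c i l * A l m) *: f x0.
    rewrite scaler_suml; apply: eq_bigr => l _.
    by rewrite scalrfctE vA (zP _).1 scalerA.
  move=> /eqP; rewrite -subr_eq0 -scalerBl scaler_eq0.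
  rewrite (negbTE fx0) orbF subr_eq0 => /eqP /esym; rewrite /delta eq_sym => <-.
  by apply: eq_bigr => l _; rewrite !mxE.
have := mulmx_max_rank C D; rewrite CD mxrank1.
by rewrite ltnn.
Qed.

Lemma bubble_space_closed (q : R) : 1 <= q ->
  closed_in (Lip0_p_compact_space q E F) bubble_space.
Proof.
move=> q1 h [[h0 /lipschitzP[c c0 hc]] _] happ.
have approx d : 0 < d ->
    exists a, forall x, rnorm (h x - B a x) <= d * rnorm x.
  move=> d0; have [_ [a _ ->] had] := happ d d0; exists a => x.
  have := m_p_slopes_lt q d _ q1 had x 0.
  have subE y : (h - B a) y = h y - B a y by [].
  by rewrite !subE h0 bubbles0// 3!subr0.
have /choice[z zP] j : exists z, forall a, B a z = a j *: f x0.
  have [z zP] := bubbles_full j x0 x0; exists (x0 + z) => a.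
  by have [] := zP a.
(* At [z j] all approximants are multiples of [f x0], and a line is closed. This defines the limit
   coefficients. *)
have line j : exists b : K, h (z j) = b *: f x0.
  apply: line_closed => // d d0.
  have nz : 0 < rnorm (z j) + 1 by rewrite ltr_wpDl ?rnorm_ge0.
  have [a /(_ (z j))] := approx _ (divr_gt0 d0 nz).
  rewrite zP => had; exists (a j); rewrite (le_lt_trans had)//.
  by rewrite mulrAC ltr_pdivrMr// ltr_pM2l// ltrDl.
have {line}/choice[b bP] := line.
have hB : h = B b.
  apply/funext => x; apply/eqP; rewrite -subr_eq0 -rnorm_eq0.
  rewrite eq_le rnorm_ge0 andbT {1}/bubbles.
  set j := logn 2 _; set U := truncation f _ _.
  have n0 : 0 < rnorm (f x0) by rewrite rnorm_gt0.
  apply: (@le0_small _ _ (rnorm x + rnorm (z j) / rnorm (f x0) * rnorm U)).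
    by rewrite addr_ge0 ?mulr_ge0 ?invr_ge0 ?rnorm_ge0.
  (* The error at [x] splits into h - B a and the coefficient error b j - a j; the latter is read
     off at [z j], where h - B a equals (b j - a j) f x0. *)
  move=> d d0; have [a ha] := approx _ d0.
  have -> : h x - b j *: U = (h x - B a x) - (b j - a j) *: U.
    by rewrite scalerBl opprB addrA /B subrK.
  rewrite (le_trans (ler_rnormD _ _))// mulrDr lerD// rnormN rnormZ mulrA.
  rewrite ler_wpM2r ?rnorm_ge0// mulrA ler_pdivlMr// -rnormZ scalerBl.
  by rewrite -bP -zP.
(* Boundedness of [b] comes from the Lipschitz constant [c] of the limit [h] itself. *)
exists b => //; exists (c * rnorm x0 / rnorm (f x0)).
by apply: bubbles_bounded => //; rewrite -hB.
Qed.

End BubbleSpace.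

Theorem proposition4p2 (R : realType) (k : scalar_kind)
    (E F : completeNormedModType (scalars R k)) (p q : R) (s : \bar R)
    (E_infinite : ~ finite_dim [set: E]) (F_infinite : ~ finite_dim [set: F])
    (p_ge1 : 1 <= p) (p_lt_q : p < q) (s_ge1 : (1 <= s)%E)
    (Kq_neq_Kp :
       p_compact_op q (@ell_bar R k 1%E) (@ell_bar R k s) `\`
       p_compact_op p (@ell_bar R k 1%E) (@ell_bar R k s) !=set0)
    (ell_embed : embed_uniformly s F) :
  Lip0_p_compact q E F `\` Lip0_p_compact p E F = set0 \/
  spaceable (Lip0_p_compact_space q E F)
    (Lip0_p_compact q E F `\` Lip0_p_compact p E F).
Proof.
have q_ge1 : 1 <= q by rewrite ltW// (le_lt_trans p_ge1).
have [|/set0P[f [fq nfp]]] :=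
    eqVneq (Lip0_p_compact q E F `\` Lip0_p_compact p E F) set0.
  by left.
right; have [[f0 fL] _] := fq.
have nf : ~ p_compact (whole F) p (slopes f) by move=> fp; apply: nfp.
(* A zero map has only the slope 0, which the zero sequence generates, so it would be p-compact. *)
have [x0 /eqP fx0] : exists x0, f x0 <> 0.
  apply: contrapT => /forallNP f_eq0; apply: nf.
  exists (fun=> 0); split=> // [|_ [u [v [_ ->]]]].
    rewrite /p_norm (_ : (fun _ => _) = cst 0%E) ?Lnorm0 ?ltry//.
      by rewrite gt_eqF// lte_fin (lt_le_trans ltr01).
    by apply/funext => n /=; rewrite rnorm0.
  have /contrapT -> := f_eq0 u; have /contrapT -> := f_eq0 v.
  by rewrite subrr scaler0; exact: p_hull0.
have x0_neq0 : rnorm x0 != 0.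
  by rewrite rnorm_eq0; apply: contra_neq fx0 => ->.
(* The centers are placed along the direction of [x0], which is nonzero because f 0 = 0. *)
pose e := of_real k (rnorm x0)^-1 *: x0.
have e1 : rnorm e = 1.
  by rewrite rnormZ rnorm_of_real ger0_norm ?invr_ge0 ?rnorm_ge0// mulVf.
have spaceq a : (exists M, forall j, rnorm (a j) <= M) ->
    Lip0_p_compact q E F (bubbles f e a).
  by case=> M; exact: bubbles_compact.
exists (bubble_space f e); split.
- by move=> _ [a aM ->]; exact: spaceq.
- exact: bubble_space_submod.
- exact: (bubble_space_infinite f e x0).
- exact: (bubble_space_closed f e x0).
- move=> _ [a aM ->].
  have [a0|/existsNP[j /eqP aj]] := pselect (forall j, a j = 0).
    by right; apply/funext => x; rewrite /bubbles a0 scale0r.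
  left; split; first exact: spaceq.
  by case=> _; apply: (bubbles_not_compact f e e1 p a j).
Qed.
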